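(* Let $f(z)=z+c_1z^2+c_2z^3+\dots$ be a formal power series (the $c_j$ being complex numbers or formal variables), and let $p\in\mathbb C$. All sums below run over sequences $\mathbf m=(m_1,m_2,\dots)$ of nonnegative integers with only finitely many nonzero entries, and all products run over $j\ge 1$. (a) One has $$\frac{z^{p+2} f'(z)^2}{f(z)^{p+2}}=\sum_{\mathbf m} \mathfrak a_{\mathbf m}(p)\, \frac{c^{\mathbf m}}{\prod_j m_j!}\, z^{\|\mathbf m\|},$$ where $\mathfrak a_{0}(p)=1$ for $\mathbf m=0$ and, for $\mathbf m\neq 0$, $$\mathfrak a_{\mathbf m}(p)=(-1)^{|\mathbf m|}\frac{(p+|\mathbf m|-1)!}{(p+1)!}\cdot\Bigl\{p(p+1)+M_1^2-2(p+1)M_1-M_2\Bigr\}.$$ (b) One has $$\frac{z^{p+1} f''(z)}{f(z)^p}=\sum_{\mathbf m\ne 0} \mathfrak b_{\mathbf m}(p)\,\frac{c^{\mathbf m}}{\prod_j m_j!}\, z^{\|\mathbf m\|},\qquad \mathfrak b_{\mathbf m}(p)=(-1)^{|\mathbf m|+1}\frac{(p+|\mathbf m|-2)!}{(p-1)!}\cdot\bigl\{M_1+M_2\bigr\}.$$ (c) For the Schwarzian derivative $$S_f(z)=2\frac{f'''(z)}{f'(z)}- 3 \frac{f''(z)^2}{f'(z)^2}$$ one has the expansion $$z^2 S_f(z)=\sum_{\mathbf m\neq 0} \mathfrak d_{\mathbf m}\, \frac{ c^{\mathbf m}\prod_j (j+1)^{ m_j}}{\prod_j m_j!}\, z^{\|\mathbf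 m\|},\qquad \mathfrak d_{\mathbf m}=(-1)^{|\mathbf m|} (|\mathbf m|-1)!\cdot\bigl\{M_2-3M_1^2+2M_1\bigr\}.$$
   Context: For a finitely supported sequence $\mathbf m=(m_1,m_2,\dots)$ of nonnegative integers put $c^{\mathbf m}=c_1^{m_1}c_2^{m_2}\cdots$, $M_0=|\mathbf m|=\sum_j m_j$, $M_1=\|\mathbf m\|=\sum_j j\,m_j$, $M_2=\sum_j j^2m_j$. The expression $z^{p+2}f'(z)^2/f(z)^{p+2}$ means $f'(z)^2\,(f(z)/z)^{-(p+2)}$, and $z^{p+1}f''(z)/f(z)^p$ means $z f''(z)\,(f(z)/z)^{-p}$; here $f(z)/z=1+c_1z+c_2z^2+\dots$ and complex powers of a series with constant term $1$ are taken by the binomial series. Ratios of factorials are read as rational functions of $p$: $\frac{(p+n-1)!}{(p+1)!}=(p+2)(p+3)\cdots(p+n-1)$ for $n\ge 2$ (equal to $1$ for $n=2$), and $\frac{p!}{(p+1)!}=\frac1{p+1}$ for $n=1$. When $|\mathbf m|=1$ one has $M_1^2=M_2$, the bracket in $\mathfrak a_{\mathbf m}(p)$ equals $(p+1)(p-2M_1)$, and $\mathfrak a_{\mathbf m}(p)$ is read as $2M_1-p$ also at $p=-1$. Likewise $\frac{(p+n-2)!}{(p-1)!}=p(p+1)\cdots(p+n-2)$ for $n\ge1$ (equal to $1$ for $n=1$). *)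

(* Defs.v *)
From HB Require Import structures.
From mathcomp Require Import all_boot all_order all_algebra.
From mathcomp Require Import finmap complex.
From mathcomp Require Import all_classical reals.

Set Implicit Arguments.
Unset Strict Implicit.
Unset Printing Implicit Defensive.

Import GRing.Theory.
Local Open Scope ring_scope.

(* A formal power series a_0 + a_1 z + a_2 z^2 + ... is the sequence of its
   coefficients, wrapped in a record so that its product is the Cauchy product
   and not the pointwise product of functions. *)
Record fps (A : Type) := Fps { fps_coef :> nat -> A }.

Section FpsRing.
Variable A : comNzRingType.
Implicit Types a b : fps A.

HB.instance Definition _ := gen_eqMixin (fps A).
HB.instance Definition _ := gen_choiceMixin (fps A).

Lemma fpsP a b : (forall n, a n = b n) <-> a = b.
Proof.
split=> [ab|-> //]; case: a ab => a; case: b => b /= ab.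
by congr Fps; apply/funext.
Qed.

Definition fps_zero : fps A := Fps (fun n => 0).
Definition fps_opp a : fps A := Fps (fun n => - a n).
Definition fps_add a b : fps A := Fps (fun n => a n + b n).
Definition fps_one : fps A := Fps (fun n => (n == 0%N)%:R).
Definition fps_mul a b : fps A := Fps (fun n => \sum_(i < n.+1) a i * b (n - i)%N).

Fact fps_addA : associative fps_add.
Proof. by move=> a b c; apply/fpsP => n /=; rewrite addrA. Qed.
Fact fps_addC : commutative fps_add.
Proof. by move=> a b; apply/fpsP => n /=; rewrite addrC. Qed.
Fact fps_add0 : left_id fps_zero fps_add.
Proof. by move=> a; apply/fpsP => n /=; rewrite add0r. Qed.
Fact fps_addN : left_inverse fps_zero fps_opp fps_add.
Proof. by move=> a; apply/fpsP => n /=; rewrite addNr. Qed.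

HB.instance Definition _ :=
  GRing.isZmodule.Build (fps A) fps_addA fps_addC fps_add0 fps_addN.

Let trunc a N : {poly A} := \poly_(i < N) a i.

Fact fps_mul_trunc a b n N : (n < N)%N ->
  fps_mul a b n = (trunc a N * trunc b N)`_n.
Proof.
move=> nN; rewrite coefM /=; apply: eq_bigr => i _.
by rewrite !coef_poly (leq_ltn_trans (leq_subr _ _) nN)
  (leq_trans (ltn_ord i) nN).
Qed.

Fact fps_mulA : associative fps_mul.
Proof.
move=> a b c; apply/fpsP => n.
transitivity (trunc a n.+1 * trunc b n.+1 * trunc c n.+1)`_n.
  rewrite -mulrA coefM; apply: eq_bigr => i _.
  rewrite coef_poly ltn_ord; congr (_ * _).
  by rewrite (@fps_mul_trunc b c _ n.+1) // ltnS leq_subr.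
rewrite coefM; apply: eq_bigr => i _.
by rewrite coef_poly ltnS leq_subr (@fps_mul_trunc a b _ n.+1).
Qed.

Fact fps_mulC : commutative fps_mul.
Proof.
by move=> a b; apply/fpsP => n; rewrite !(@fps_mul_trunc _ _ _ n.+1) // mulrC.
Qed.

Fact fps_mul1 : left_id fps_one fps_mul.
Proof.
move=> a; apply/fpsP => n /=; rewrite big_ord_recl /= mul1r subn0 big1 ?addr0 //.
by move=> i _; rewrite mul0r.
Qed.

Fact fps_mulDl : left_distributive fps_mul fps_add.
Proof.
move=> a b c; apply/fpsP => n /=; rewrite -big_split /=.
by apply: eq_bigr => i _; rewrite mulrDl.
Qed.

Fact fps_oner_neq0 : fps_one != fps_zero.
Proof.
by apply/eqP => /(congr1 (fun a : fps A => a 0%N)) /eqP; rewrite /= oner_eq0.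
Qed.

HB.instance Definition _ := GRing.Zmodule_isComNzRing.Build (fps A)
  fps_mulA fps_mulC fps_mul1 fps_mulDl fps_oner_neq0.

Definition fps_unit : {pred fps A} := fun a => `[< exists b, b * a = 1 >].

Definition fps_inv a : fps A :=
  if pselect (exists b, b * a = 1) is left aV then projT1 (cid aV) else a.

Fact fps_mulVx : {in fps_unit, left_inverse 1 fps_inv *%R}.
Proof.
move=> a /asboolP aV; rewrite /fps_inv; case: pselect => // aV'.
by case: cid.
Qed.

Fact fps_unitPl a b : b * a = 1 -> fps_unit a.
Proof. by move=> ba1; apply/asboolP; exists b. Qed.

Fact fps_inv_out : {in [predC fps_unit], fps_inv =1 id}.
Proof. by move=> a /asboolPn aV; rewrite /fps_inv; case: pselect. Qed.

HB.instance Definition _ := GRing.ComNzRing_hasMulInverse.Build (fps A)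
  fps_mulVx fps_unitPl fps_inv_out.

Lemma fps_coefD a b n : (a + b) n = a n + b n. Proof. by []. Qed.
Lemma fps_coefN a n : (- a) n = - a n. Proof. by []. Qed.
Lemma fps_coef1 n : (1 : fps A) n = (n == 0%N)%:R. Proof. by []. Qed.
Lemma fps_coefM a b n : (a * b) n = \sum_(i < n.+1) a i * b (n - i)%N.
Proof. by []. Qed.

Lemma fps_exp_low a k n : a 0%N = 0 -> (n < k)%N -> (a ^+ k) n = 0.
Proof.
move=> a0; elim: k n => // k IHk n ltnk.
rewrite exprS fps_coefM big_ord_recl a0 mul0r add0r big1 // => i _.
rewrite IHk ?mulr0 //; rewrite ltnS in ltnk; apply: (leq_trans _ ltnk) => /=.
by rewrite ltn_subrL (leq_ltn_trans _ (ltn_ord i)).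
Qed.

Lemma fps_unit1 a : a 0%N = 1 -> a \is a GRing.unit.
Proof.
move=> a0; apply/unitrPr.
pose s n := \sum_(k < n.+1) (1 - a) ^+ k.
have u0 : (1 - a) 0%N = 0 by rewrite fps_coefD fps_coefN a0 fps_coef1 subrr.
have sE n m : (n <= m)%N -> s n n = s m n.
  move/subnKC <-; elim: (m - n)%N => [|k ->]; first by rewrite addn0.
  by rewrite addnS /s [in RHS]big_ord_recr fps_coefD fps_exp_low ?addr0 //
    ltnS leq_addr.
exists (Fps (fun n => s n n)); apply/fpsP => n; rewrite fps_coefM.
under eq_bigr => i _ do rewrite /= (sE _ n) ?leq_subr //.
rewrite -fps_coefM.
have -> : a * s n = 1 - (1 - a) ^+ n.+1.
  by rewrite -[in LHS](subKr 1 a) -opprB -[in RHS]opprB mulNr subrX1.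
by rewrite fps_coefD fps_coefN fps_exp_low // subr0.
Qed.

Definition fps_deriv a : fps A := Fps (fun n => a n.+1 *+ n.+1).

(* a_(k+1) + a_(k+2) z + ...; for k = 0 this is a / z when a 0%N = 0. *)
Definition fps_divz a : fps A := Fps (fun n => a n.+1).

Definition fps_mono (n : nat) (x : A) : fps A :=
  Fps (fun k => if k == n then x else 0).

Definition fps_z : fps A := fps_mono 1 1.

(* The formal identity s = sum_(i in D) F i: each power of z receives a nonzero
   contribution from only finitely many i, and the coefficient of s is the sum
   of these contributions. *)
Definition fps_has_sum (I : choiceType) (D : set I) (F : I -> fps A) (s : fps A)
    : Prop :=
  forall n, finite_set [set i | D i /\ F i n <> 0]%classic /\
            s n = \sum_(i \in D) F i n.

End FpsRing.

Section BinomialSeries.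
Variables (K : fieldType) (A : comAlgType K).

Definition gbinom (x : K) (k : nat) : K := (\prod_(i < k) (x - i%:R)) / k`!%:R.

(* g^x = sum_k binom(x, k) (g - 1)^k for g with constant term 1.  As
   (g - 1)^k is divisible by z^k, only k <= n contribute to z^n; see
   fps_cpow_binomial. *)
Definition fps_cpow (g : fps A) (x : K) : fps A :=
  Fps (fun n => \sum_(k < n.+1) gbinom x k *: ((g - 1) ^+ k) n).

Lemma fps_cpow_binomial (g : fps A) (x : K) : g 0%N = 1 ->
  fps_has_sum [set: nat]
    (fun k => Fps (fun n => gbinom x k *: ((g - 1) ^+ k) n)) (fps_cpow g x).
Proof.
move=> g0 n; have u0 : (g - 1) 0%N = 0.
  by rewrite fps_coefD fps_coefN g0 fps_coef1 subrr.
have F0 k : (n < k)%N -> gbinom x k *: ((g - 1) ^+ k) n = 0.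
  by move=> ltnk; rewrite fps_exp_low ?scaler0.
split.
  apply: (sub_finite_set _ (finite_II n.+1)) => k [_ /= Fk].
  by rewrite ltnS leqNgt; apply/negP => /F0.
rewrite -(@fsbig_widen _ _ _ _ `I_n.+1) //= => [|k [_ /= /negP]]; last first.
  by rewrite -leqNgt => /F0.
by rewrite -fsbig_ord.
Qed.

End BinomialSeries.

(* A finitely supported sequence (m_1, m_2, ...) is indexed from 0:
   m i stands for m_(i+1). *)
Definition mindex := {fsfun nat -> nat with 0%N}.

Definition mindex0 : mindex := [fsfun].

(* M_k = sum_j j^k m_j *)
Definition moment (k : nat) (m : mindex) : nat :=
  \sum_(i <- finsupp m) i.+1 ^ k * m i.

Definition mfact (m : mindex) : nat := \prod_(i <- finsupp m) (m i)`!.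

Section Expansion.
Variables (K : fieldType) (A : comAlgType K).

(* The sequence (c_1, c_2, ...) is also indexed from 0: c i stands for
   c_(i+1). *)
Implicit Type c : nat -> A.

(* z + c_1 z^2 + c_2 z^3 + ... *)
Definition normalized_fps c : fps A :=
  Fps (fun n => match n with 0%N => 0 | 1%N => 1 | k.+2 => c k end).

Definition mmonom c (m : mindex) : A := \prod_(i <- finsupp m) c i ^+ m i.

(* (p+n-1)! / (p+1)! for n >= 1 *)
Definition fact_ratio_a (p : K) (n : nat) : K :=
  if n == 1%N then (p + 1)^-1 else \prod_(2 <= i < n) (p + i%:R).

(* (p+n-2)! / (p-1)! for n >= 1 *)
Definition fact_ratio_b (p : K) (n : nat) : K :=
  \prod_(0 <= i < n.-1) (p + i%:R).

(* For |m| = 1 the general formula reduces to 2 M_1 - p; this value is also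
   taken at p = -1, where the factor 1 / (p + 1) is undefined. *)
Definition coef_a (p : K) (m : mindex) : K :=
  let M0 := moment 0 m in
  let M1 : K := (moment 1 m)%:R in
  let M2 : K := (moment 2 m)%:R in
  if m == mindex0 then 1
  else if (M0 == 1%N) && (p == - 1) then 2 * M1 - p
  else (- 1) ^+ M0 * fact_ratio_a p M0
       * (p * (p + 1) + M1 ^+ 2 - 2 * (p + 1) * M1 - M2).

Definition coef_b (p : K) (m : mindex) : K :=
  let M0 := moment 0 m in
  let M1 : K := (moment 1 m)%:R in
  let M2 : K := (moment 2 m)%:R in
  (- 1) ^+ M0.+1 * fact_ratio_b p M0 * (M1 + M2).

Definition coef_d (m : mindex) : K :=
  let M0 := moment 0 m in
  let M1 : K := (moment 1 m)%:R in
  let M2 : K := (moment 2 m)%:R in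
  (- 1) ^+ M0 * (M0.-1)`!%:R * (M2 - 3 * M1 ^+ 2 + 2 * M1).

(* The derivative of a normalized series is a unit (see fps_unit1), so the
   quotients are genuine divisions of power series. *)
Definition schwarzian (f : fps A) : fps A :=
  let f1 := fps_deriv f in
  let f2 := fps_deriv f1 in
  let f3 := fps_deriv f2 in
  2 * (f3 / f1) - 3 * (f2 ^+ 2 / f1 ^+ 2).

End Expansion.

Arguments coef_d {K} m.

(* Main.v *)
Require Import Defs.
From mathcomp Require Import all_boot all_order all_algebra.
From mathcomp Require Import finmap complex ring.
From mathcomp Require Import all_classical reals.

Set Implicit Arguments.
Unset Strict Implicit.
Unset Printing Implicit Defensive.

Import GRing.Theory Num.Theory.
Local Open Scope ring_scope.

(** All three identities are computed inside the series of the form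
    expansion c a = sum_m a(m) c^m / prod_j m_j! z^||m||, where they become
    identities between the coefficients a(m). What makes this possible is that
    multiplying such a series by L_h = sum_j h_j c_j z^j gives another one:
    since c_j c^(m - e_j) / (m - e_j)! = m_j c^m / m!, its coefficient at m is
    sum_j h_j m_j a(m - e_j) (linear_mul_expansion). When a(m) = phi(|m|)
    depends on the length |m| alone, one multiplication by L_h turns it into
    (sum_j h_j m_j) phi(|m| - 1), and two of them, by L_h and L_h', into
      ((sum_j h'_j m_j) (sum_j h_j m_j) - sum_j h'_j h_j m_j) phi(|m| - 2).

    Write g = f / z = 1 + u with u = sum_j c_j z^j. As u is itself an L_h, its
    powers, and hence the binomial series g^x, are expansions: g^x has the
    coefficients x (x - 1) ... (x - |m| + 1) (fps_cpow_expansion). In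
    particular g g^x = g^(x+1), which follows from Pascal's rule for falling
    factorials (mul_fps_cpow).

    With the derivation D = z d/dz one has f' = g + Dg and z f'' = Dg + D^2 g,
    where Dg and D^2 g are the series L_h for h_j = j and h_j = j^2. Therefore
      f'^2 g^(-p-2) = g^(-p) + 2 Dg g^(-p-1) + (Dg)^2 g^(-p-2),
    and the multiplication rules give (a), with M_1^2 - M_2 coming from the
    square of Dg; likewise they give (b). For (c) put G = f', a series with
    constant term 1 in the variables (j + 1) c_j, for which
      z^2 S_f = 2 (D^2 G - DG) G^(-1) - 3 (DG)^2 G^(-2). *)

(** * Adding one to an entry of a multi-index *)

Definition mincr (j : nat) (m : mindex) : mindex := [fsfun m with j |-> (m j).+1].

Definition mdecr (j : nat) (m : mindex) : mindex := [fsfun m with j |-> (m j).-1].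

Lemma mincrK j : cancel (mincr j) (mdecr j).
Proof.
move=> m; apply/fsfunP => i; rewrite !fsfun_withE eqxx /=.
by case: eqP => [->|].
Qed.

Lemma mdecrK j (m : mindex) : m j != 0%N -> mincr j (mdecr j m) = m.
Proof.
move=> mj; apply/fsfunP => i; rewrite !fsfun_withE eqxx /= prednK ?lt0n //.
by case: eqP => [->|].
Qed.

Section BigFinsupp.
Variables (R : Type) (idx : R) (op : Monoid.com_law idx) (F : nat -> nat -> R).
Hypothesis F0 : forall i, F i 0%N = idx.

(** The entry j may vanish: this allows a multi-index to be compared with the one
    obtained by raising this entry, whose support may be larger. *)
Lemma big_finsuppD1 j (m : mindex) :
  \big[op/idx]_(i <- finsupp m) F i (m i) =
  op (F j (m j)) (\big[op/idx]_(i <- (finsupp m `\ j)%fset) F i (m i)).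
Proof.
have [jm|jNm] := boolP (j \in finsupp m); first by rewrite (big_fsetD1 j).
by rewrite fsfun_dflt // F0 Monoid.mul1m mem_fsetD1.
Qed.

Lemma big_finsupp_mincr j (m : mindex) :
  \big[op/idx]_(i <- finsupp (mincr j m)) F i (mincr j m i) =
  op (F j (m j).+1) (\big[op/idx]_(i <- (finsupp m `\ j)%fset) F i (m i)).
Proof.
rewrite (big_finsuppD1 j) fsfun_with; congr (op _ _).
have -> : (finsupp (mincr j m) `\ j = finsupp m `\ j)%fset.
  rewrite finsupp_with /=; apply/fsetP => i; rewrite !inE.
  by case: (i =P j).
apply: eq_big_seq => i; rewrite !inE => /andP[/negbTE ij _].
by rewrite fsfun_withE ij.
Qed.

End BigFinsupp.

Lemma moment_mincr k j m : moment k (mincr j m) = (j.+1 ^ k + moment k m)%N.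
Proof.
have F0 i : (i.+1 ^ k * 0 = 0)%N by rewrite muln0.
rewrite /moment (big_finsupp_mincr _ (F := fun i x => i.+1 ^ k * x)%N F0).
rewrite (big_finsuppD1 _ (F := fun i x => i.+1 ^ k * x)%N F0 j) /=.
by rewrite mulnS addnA.
Qed.

Lemma mfact_mincr j m : mfact (mincr j m) = ((m j).+1 * mfact m)%N.
Proof.
have F0 (i : nat) : 0`! = 1%N by [].
rewrite /mfact (big_finsupp_mincr _ (F := fun=> factorial) F0).
rewrite (big_finsuppD1 _ (F := fun=> factorial) F0 j) /=.
by rewrite factS mulnA.
Qed.

Lemma mfact_neq0 (K : numFieldType) m : (mfact m)%:R != 0 :> K.
Proof.
rewrite pnatr_eq0 -lt0n /mfact.
by elim/big_ind: _ => // [x y x0 y0|i _]; rewrite ?muln_gt0 ?x0 ?fact_gt0.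
Qed.

Lemma moment_mindex0 k : moment k mindex0 = 0%N.
Proof. by rewrite /moment finsupp0 big_nil. Qed.

Lemma mindex_neq0 m : m != mindex0 -> exists j, m j != 0%N.
Proof.
move=> m0; apply: contrapT => mN; case/eqP: m0; apply/fsfunP => i.
rewrite [RHS]fsfun_dflt ?finsupp0 //.
by apply/eqP/negPn/negP => mi; apply: mN; exists i.
Qed.

Lemma leq_moment k j (m : mindex) : m j != 0%N -> (j.+1 ^ k <= moment k m)%N.
Proof. by move=> /mdecrK <-; rewrite moment_mincr leq_addr. Qed.

Lemma moment_eq0 k m : (moment k m == 0%N) = (m == mindex0).
Proof.
apply/idP/eqP => [m0|->]; last by rewrite moment_mindex0.
apply/eqP/contraT => /mindex_neq0[j /(leq_moment k)].
by rewrite (eqP m0) leqn0 expn_eq0.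
Qed.

Lemma leq_moment0 k m : (moment 0 m <= moment k m)%N.
Proof.
apply: leq_sum => i _; rewrite expn0 leq_mul2r orbC.
by rewrite expn_gt0.
Qed.

(** * Multi-indices of a given degree *)

Definition grade (n : nat) : set mindex := [set m | moment 1 m = n]%classic.

(** A nonzero multi-index of degree n arises from one of degree n - j by raising
    its entry j, so induction on n exhibits the set as a finite union of images
    of finite sets. *)
Lemma finite_grade n : finite_set (grade n).
Proof.
elim/ltn_ind: n => n IHn.
apply: (@sub_finite_set _ _ ([set mindex0] `|`
    \bigcup_(j in `I_n) (mincr j @` grade (n - j.+1)))%classic) => [m mn|].
  have [->|/mindex_neq0[j mj]] := eqVneq m mindex0; first by left.
  right; have := leq_moment 1 mj; rewrite mn expn1 => jn; exists j => //.
  exists (mdecr j m); last exact: mdecrK.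
  by rewrite /grade /= -mn -{2}(mdecrK mj) moment_mincr expn1 addKn.
rewrite finite_setU; split; first exact: finite_set1.
apply: bigcup_finite => [|j /= jn]; first exact: finite_II.
by apply/finite_image/IHn; rewrite ltn_subrL (leq_trans _ jn).
Qed.

Lemma mincr_grade_bij n j : (j < n)%N ->
  set_bij (grade (n - j.+1)) (grade n `&` [set m | m j != 0%N])%classic (mincr j).
Proof.
move=> jn; split.
- move=> m /= mn; split; last by rewrite fsfun_with.
  by rewrite /grade /= moment_mincr mn expn1 subnKC.
- by move=> m m' _ _; apply: can_inj (mincrK j) _ _.
- move=> m /= [mn mj]; exists (mdecr j m); last exact: mdecrK.
  by rewrite /grade /= -mn -{2}(mdecrK mj) moment_mincr expn1 addKn.
Qed.

(** * Expansions over multi-indices *)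

Section Expansion.
Variables (K : numFieldType) (A : comAlgType K).
Implicit Types (c : nat -> A) (a b : mindex -> K) (h : nat -> K) (m : mindex).

Definition expansion c a : fps A :=
  Fps (fun n => \sum_(m \in grade n) (a m / (mfact m)%:R) *: mmonom c m).

(** The image of sum_j c_j z^j under the derivation that multiplies c_j by h_j. *)
Definition linear_fps c h : fps A :=
  Fps (fun n => if n is k.+1 then h k *: c k else 0).

(** The eigenvalue of c^m for the derivation that multiplies c_j by h_j; the
    moments M_k are the case h_j = j^k. *)
Definition mweight h m : K := \sum_(i <- finsupp m) h i * (m i)%:R.

Lemma mmonom_mincr c j m : mmonom c (mincr j m) = c j * mmonom c m.
Proof.
have F0 i : c i ^+ 0 = 1 by rewrite expr0.
rewrite /mmonom (big_finsupp_mincr _ (F := fun i x => c i ^+ x) F0).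
rewrite (big_finsuppD1 _ (F := fun i x => c i ^+ x) F0 j) /=.
by rewrite exprS mulrA.
Qed.

Lemma mweight_mincr h j m : mweight h (mincr j m) = h j + mweight h m.
Proof.
have F0 i : h i * 0%:R = 0 by rewrite mulr0.
rewrite /mweight (big_finsupp_mincr _ (F := fun i k => h i * k%:R) F0).
rewrite (big_finsuppD1 _ (F := fun i k => h i * k%:R) F0 j) /=.
by rewrite -natr1 mulrDr mulr1 addrA [h j + _]addrC.
Qed.

Lemma mweight_mdecr h j m :
  m j != 0%N -> mweight h (mdecr j m) = mweight h m - h j.
Proof. by move=> mj; rewrite -{2}(mdecrK mj) mweight_mincr addrC addKr. Qed.

Lemma moment_mdecr k j m :
  m j != 0%N -> moment k (mdecr j m) = (moment k m - j.+1 ^ k)%N.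
Proof. by move=> mj; rewrite -{2}(mdecrK mj) moment_mincr addKn. Qed.

Lemma mweight_moment k m : mweight (fun i => (i.+1 ^ k)%:R) m = (moment k m)%:R.
Proof. by rewrite /moment natr_sum; apply: eq_bigr => i _; rewrite natrM. Qed.

Lemma mweightD h h' m : mweight (fun i => h i + h' i) m = mweight h m + mweight h' m.
Proof. by rewrite -big_split; apply: eq_bigr => i _; rewrite mulrDl. Qed.

Lemma mweightB h h' m : mweight (fun i => h i - h' i) m = mweight h m - mweight h' m.
Proof. by rewrite -sumrB; apply: eq_bigr => i _; rewrite mulrBl. Qed.

Lemma eq_mweight h h' m : h =1 h' -> mweight h m = mweight h' m.
Proof. by move=> hh'; apply: eq_bigr => i _; rewrite hh'. Qed.

Lemma mweight_M0 m : mweight (fun=> 1) m = (moment 0 m)%:R.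
Proof. by rewrite -mweight_moment; apply: eq_mweight => i; rewrite expn0. Qed.

Lemma mweight_M1 m : mweight (fun i => i.+1%:R) m = (moment 1 m)%:R.
Proof. by rewrite -mweight_moment; apply: eq_mweight => i; rewrite expn1. Qed.

Lemma mweight_M2 m : mweight (fun i => i.+1%:R * i.+1%:R) m = (moment 2 m)%:R.
Proof. by rewrite -mweight_moment; apply: eq_mweight => i; rewrite -natrM. Qed.

Lemma eq_expansion c a b : a =1 b -> expansion c a = expansion c b.
Proof. by move=> ab; congr expansion; apply/funext. Qed.

Lemma expansionD c a b :
  expansion c a + expansion c b = expansion c (fun m => a m + b m).
Proof.
apply/fpsP => n /=; rewrite !(fsbig_finite _ _ (finite_grade n)) -big_split /=.
by apply: eq_bigr => m _; rewrite mulrDl scalerDl.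
Qed.

Lemma expansionN c a : - expansion c a = expansion c (fun m => - a m).
Proof.
apply/fpsP => n /=; rewrite !(fsbig_finite _ _ (finite_grade n)) -sumrN /=.
by apply: eq_bigr => m _; rewrite mulNr scaleNr.
Qed.

Lemma expansion_has_sum c a (D : set mindex) (t : mindex -> A) :
    (forall m, t m = (a m / (mfact m)%:R) *: mmonom c m) ->
    (forall m, ~ D m -> a m = 0) ->
  fps_has_sum D (fun m => fps_mono (moment 1 m) (t m)) (expansion c a).
Proof.
move=> ta a0 n; split.
  apply: sub_finite_set (finite_grade n) => m [_ /=].
  by case: eqP.
rewrite /= [LHS]fsbig_mkcond [RHS]fsbig_mkcond.
apply: eq_fsbigr => m _; rewrite /patch.
have [|mn] := boolP (m \in grade n).
  rewrite inE /grade /= => <-; rewrite eqxx.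
  case: ifPn => [_|]; first by rewrite ta.
  by rewrite notin_setE => /a0 ->; rewrite mul0r scale0r.
by case: ifP => // _; case: eqP => // nm; case/negP: mn; rewrite inE.
Qed.

(** The entries of a multi-index of degree n vanish beyond the n-th, so that one
    range of indices serves for all of them. *)
Lemma mweight_degree (F : nat -> K) n m : grade n m ->
  \sum_(i <- finsupp m) F i * (m i)%:R = \sum_(i < n) F i * (m i)%:R.
Proof.
move=> mn; rewrite -(big_mkord xpredT (fun i => F i * (m i)%:R)).
rewrite [RHS](@bigfs _ _ _ _ _ xpredT) ?iota_uniq // => [|i _ iN]; last first.
  apply/eqP; rewrite mulf_eq0 pnatr_eq0; apply/orP; right.
  apply: contraNT iN => /(leq_moment 1); rewrite mn expn1.
  by rewrite mem_index_iota.
rewrite [LHS](@bigfs _ _ _ _ _ xpredT) ?fset_uniq // => i _ iN.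
by rewrite fsfun_dflt // mulr0.
Qed.

(** For each j the map m |-> m + e_j is a bijection onto the multi-indices with
    m_j > 0; it multiplies c^m by c_j and the product of the m_j! by m_j + 1. The
    multi-indices with m_j = 0 contribute nothing to the right-hand side. *)
Lemma linear_mul_expansion c h a :
  linear_fps c h * expansion c a =
  expansion c (fun m => \sum_(j <- finsupp m) h j * a (mdecr j m) * (m j)%:R).
Proof.
apply/fpsP => n; rewrite fps_coefM big_ord_recl /= mul0r add0r.
pose t j m := ((h j * a (mdecr j m) * (m j)%:R) / (mfact m)%:R) *: mmonom c m.
transitivity (\sum_(m \in grade n) \sum_(j < n) t j m); last first.
  apply: eq_fsbigr => m; rewrite inE => mn.
  by rewrite (mweight_degree _ mn) mulr_suml scaler_suml.
rewrite [RHS](fsbig_finite _ _ (finite_grade n)) exchange_big /=.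
apply: eq_bigr => j _; rewrite -(fsbig_finite _ _ (finite_grade n)).
have -> : \sum_(m \in grade n) t j m =
    \sum_(m \in (grade n `&` [set m : mindex | m j != 0%N])%classic) t j m.
  apply/esym/fsbig_widen => [m [] //|m [mn /= mj]].
  have mj0 : m j = 0%N by apply/eqP; apply: contra_notT mj => mj; split.
  by rewrite /= /t mj0 mulr0 mul0r scale0r.
rewrite (reindex_fsbig _ _ _ _ (mincr_grade_bij (ltn_ord j))) /bump /= add1n.
rewrite !(fsbig_finite _ _ (finite_grade _)) mulr_sumr.
apply: eq_bigr => m _; rewrite /t mincrK fsfun_with mmonom_mincr mfact_mincr.
rewrite add0n -scalerAl -scalerAr scalerA natrM; congr (_ *: _).
have := mfact_neq0 K m; have : (m j).+1%:R != 0 :> K by rewrite pnatr_eq0.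
by move: (m j).+1%:R => x x0 y0; field; rewrite y0 x0.
Qed.

Lemma linear_mul_length c h (phi : nat -> K) :
  linear_fps c h * expansion c (fun m => phi (moment 0 m)) =
  expansion c (fun m => mweight h m * phi (moment 0 m).-1).
Proof.
rewrite linear_mul_expansion; apply: eq_expansion => m.
rewrite mulr_suml; apply: eq_big_seq => j; rewrite mem_finsupp => mj.
by rewrite moment_mdecr // expn0 subn1 mulrAC.
Qed.

(** Passing from m to m - e_j also lowers the weight by h_j, whence the
    correction by the weight of h' h. At |m| = 1 the truncated |m| - 2 does no
    harm, because the factor in front of phi vanishes there. *)
Lemma linear_mul_linear_mul_length c h h' (phi : nat -> K) :
  linear_fps c h' * (linear_fps c h * expansion c (fun m => phi (moment 0 m))) =
  expansion c (fun m => (mweight h' m * mweight h m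
                         - mweight (fun i => h' i * h i) m) * phi (moment 0 m).-2).
Proof.
rewrite linear_mul_length linear_mul_expansion; apply: eq_expansion => m.
rewrite mulrBl !mulr_suml -sumrB; apply: eq_big_seq => j.
rewrite mem_finsupp => mj; rewrite moment_mdecr // mweight_mdecr // expn0 subn1.
by ring.
Qed.

(** * Powers of a series with constant term one *)

Definition falling (x : K) (n : nat) : K := \prod_(i < n) (x - i%:R).

Definition rising (x : K) (n : nat) : K := \prod_(i < n) (x + i%:R).

Lemma fallingN x n : falling (- x) n = (- 1) ^+ n * rising x n.
Proof.
rewrite /falling (eq_bigr (fun i : 'I_n => - 1 * (x + i%:R))) => [|i _].
  by rewrite big_split /= prodr_const card_ord.
by rewrite mulN1r opprD.
Qed.

Lemma risingS x n : rising x n.+1 = x * rising (x + 1) n.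
Proof.
rewrite /rising big_ord_recl addr0; congr (_ * _); apply: eq_bigr => i _.
by rewrite /bump natrD addrA.
Qed.

Lemma fallingS x n : falling (x + 1) n = falling x n + n%:R * falling x n.-1.
Proof.
case: n => [|n]; first by rewrite /falling !big_ord0 mul0r addr0.
rewrite /falling big_ord_recl big_ord_recr /=.
rewrite (eq_bigr (fun i : 'I_n => x - i%:R)) => [|i _].
  by rewrite -natr1; ring.
by rewrite /bump /= -natr1; ring.
Qed.

Lemma rising1 n : rising 1 n = n`!%:R.
Proof.
elim: n => [|n IHn]; first by rewrite /rising big_ord0.
by rewrite /rising big_ord_recr -/(rising 1 n) /= IHn factS natrM -natr1; ring.
Qed.

Lemma rising2 n : rising 2 n = n.+1`!%:R.
Proof.
elim: n => [|n IHn]; first by rewrite /rising big_ord0.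
rewrite /rising big_ord_recr -/(rising 2 n) /= IHn [in RHS]factS natrM -natr1.
by rewrite -natr1; ring.
Qed.

Lemma expansion_length0 c : expansion c (fun m => (moment 0 m == 0%N)%:R) = 1.
Proof.
apply/fpsP => n; rewrite fps_coef1 /=.
have [->|n0] := eqVneq n 0%N; last first.
  rewrite fsbig1 // => m mn; rewrite moment_eq0.
  case: eqP => [m0|]; last by rewrite mul0r scale0r.
  by case/eqP: n0; rewrite -mn m0 moment_mindex0.
have -> : grade 0 = [set mindex0]%classic.
  apply/seteqP; split=> m /= => [/eqP|->]; last by rewrite /grade /= moment_mindex0.
  by rewrite moment_eq0 => /eqP.
rewrite fsbig_set1 moment_mindex0 /mfact /mmonom finsupp0 !big_nil.
by rewrite divr1 scale1r.
Qed.

(** The multinomial theorem, obtained by iterating multiplication by the series. *)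
Lemma linear_exp c k : linear_fps c (fun=> 1) ^+ k =
  expansion c (fun m => (moment 0 m == k)%:R * k`!%:R).
Proof.
elim: k => [|k IHk].
  rewrite expr0 -(expansion_length0 c); apply: eq_expansion => m.
  by rewrite mulr1.
rewrite exprS IHk.
rewrite (@linear_mul_length _ _ (fun n => (n == k)%:R * k`!%:R)).
apply: eq_expansion => m.
rewrite mweight_M0.
case: (moment 0 m) => [|n] /=; first by rewrite !mul0r.
rewrite eqSS; case: eqP => [->|_]; last by rewrite !mul0r mulr0.
by rewrite factS natrM !mul1r.
Qed.

Lemma gbinomE x k : gbinom x k * k`!%:R = falling x k.
Proof. by rewrite /gbinom divfK // pnatr_eq0 -lt0n fact_gt0. Qed.

(** The term |m| = k of the multinomial theorem has coefficient k!, which cancels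
    the denominator of the binomial coefficient of order k. *)
Lemma fps_cpow_expansion c x :
  fps_cpow (1 + linear_fps c (fun=> 1)) x =
  expansion c (fun m => falling x (moment 0 m)).
Proof.
rewrite /fps_cpow [1 + _]addrC addrK; apply/fpsP => n /=.
under eq_bigr => k _.
  rewrite linear_exp /= (fsbig_finite _ _ (finite_grade n)) scaler_sumr; over.
rewrite exchange_big /= -(fsbig_finite _ _ (finite_grade n)).
apply: eq_fsbigr => m; rewrite inE /grade /= => mn.
have Mn : (moment 0 m < n.+1)%N by rewrite ltnS -mn leq_moment0.
(* Only the power k = |m| contributes to the coefficient of c^m. *)
rewrite (bigD1 (Ordinal Mn)) //= big1 => [|i iM].
  by rewrite eqxx mul1r addr0 scalerA mulrA gbinomE.
rewrite (_ : moment 0 m == i = false) ?mul0r ?scale0r ?scaler0 //.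
by apply: contraNF iM => /eqP Mi; apply/eqP/val_inj.
Qed.

Lemma mul_fps_cpow c x (g := 1 + linear_fps c (fun=> 1)) :
  g * fps_cpow g x = fps_cpow g (x + 1).
Proof.
rewrite /g !fps_cpow_expansion mulrDl mul1r linear_mul_length expansionD.
apply: eq_expansion => m; rewrite fallingS.
by rewrite mweight_M0.
Qed.

Lemma fps_cpow0 c : fps_cpow (1 + linear_fps c (fun=> 1)) 0 = 1.
Proof.
rewrite fps_cpow_expansion -(expansion_length0 c); apply: eq_expansion => m.
case: (moment 0 m) => [|n]; first by rewrite /falling big_ord0.
by rewrite /falling big_ord_recl subr0 mul0r.
Qed.

(** * The derivatives of a normalized series *)

Lemma coef_fps_zM (s : fps A) n : (fps_z A * s) n = if n is k.+1 then s k else 0.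
Proof.
rewrite fps_coefM; case: n => [|n]; first by rewrite big_ord1 /= mul0r.
rewrite !big_ord_recl /= mul0r mul1r add0r subSS subn0 big1 ?addr0 //.
by move=> i _; rewrite mul0r.
Qed.

Lemma fps_divz_normalized c :
  fps_divz (normalized_fps c) = 1 + linear_fps c (fun=> 1).
Proof.
by apply/fpsP => -[|n]; rewrite fps_coefD fps_coef1 /= ?addr0 ?add0r ?scale1r.
Qed.

Lemma deriv_normalized c :
  fps_deriv (normalized_fps c) = 1 + linear_fps c (fun i => i.+2%:R).
Proof.
apply/fpsP => -[|n]; rewrite fps_coefD fps_coef1 /= ?addr0 ?add0r //.
by rewrite scaler_nat.
Qed.

Lemma z_deriv2_normalized c :
  fps_z A * fps_deriv (fps_deriv (normalized_fps c)) =
  linear_fps c (fun i => i.+1%:R * i.+2%:R).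
Proof.
apply/fpsP => n; rewrite coef_fps_zM; case: n => [|n] //=.
by rewrite -natrM scaler_nat mulrnA mulrnAC.
Qed.

Lemma z2_deriv3_normalized c :
  fps_z A ^+ 2 * fps_deriv (fps_deriv (fps_deriv (normalized_fps c))) =
  linear_fps c (fun i => i%:R * i.+1%:R * i.+2%:R).
Proof.
apply/fpsP => n; rewrite expr2 -mulrA coef_fps_zM; case: n => [|n] //.
rewrite coef_fps_zM; case: n => [|n] /=; first by rewrite !mul0r scale0r.
rewrite -!natrM scaler_nat -!mulrnA; congr (_ *+ _).
by rewrite mulnC [(n.+2 * _)%N]mulnC.
Qed.

Lemma linear_fpsD c h h' :
  linear_fps c (fun i => h i + h' i) = linear_fps c h + linear_fps c h'.
Proof. by apply/fpsP => -[|n]; rewrite fps_coefD /= ?addr0 ?scalerDl. Qed.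

Lemma linear_fps_scale c h h' :
  linear_fps (fun i => h' i *: c i) h = linear_fps c (fun i => h i * h' i).
Proof. by apply/fpsP => -[|n] //=; rewrite scalerA. Qed.

(** * The three expansions *)

(** In length one m = e_j. This is what makes the exceptional reading of the
    coefficients in length one agree with the general formula. *)
Lemma moment_length1 m : moment 0 m = 1%N ->
  (moment 1 m)%:R ^+ 2 = (moment 2 m)%:R :> K.
Proof.
move=> m1; have [m0|/mindex_neq0[j mj]] := eqVneq m mindex0.
  by rewrite m0 moment_mindex0 in m1.
have: moment 0 (mdecr j m) = 0%N by rewrite moment_mdecr // expn0 m1.
move/eqP; rewrite moment_eq0 => /eqP m0.
by rewrite -(mdecrK mj) m0 !moment_mincr !moment_mindex0 !addn0 -natrX expn1.
Qed.

(** Expand f'^2 g^(-p-2) with f' = g + L, where L = Dg. *)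
Lemma expansion_a c p (f := normalized_fps c) :
  fps_deriv f ^+ 2 * fps_cpow (fps_divz f) (- (p + 2)) = expansion c (coef_a p).
Proof.
set L := linear_fps c (fun i => i.+1%:R).
set P := fps_cpow _ _.
have gP : fps_divz f * P = fps_cpow (fps_divz f) (- (p + 1)).
  rewrite /P fps_divz_normalized mul_fps_cpow; congr fps_cpow.
  by rewrite -[2](natr1 1); ring.
have ggP : fps_divz f * (fps_divz f * P) = fps_cpow (fps_divz f) (- p).
  by rewrite gP fps_divz_normalized mul_fps_cpow; congr fps_cpow; ring.
have -> : fps_deriv f = fps_divz f + L.
  rewrite deriv_normalized fps_divz_normalized -addrA -linear_fpsD.
  by congr (_ + linear_fps c _); apply/funext => i; rewrite -[i.+2%:R]natr1 addrC.
have -> : (fps_divz f + L) ^+ 2 * P =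
    fps_divz f * (fps_divz f * P) + (L * (fps_divz f * P) + L * (fps_divz f * P))
    + L * (L * P).
  by rewrite expr2; ring.
rewrite ggP gP /P fps_divz_normalized !fps_cpow_expansion.
rewrite linear_mul_linear_mul_length linear_mul_length !expansionD.
apply: eq_expansion => m.
rewrite mweight_M1 mweight_M2.
rewrite /coef_a /fact_ratio_a; have [->|m0] := eqVneq m mindex0.
  by rewrite !moment_mindex0 /falling !big_ord0; ring.
have := moment_eq0 0 m; rewrite (negbTE m0); have := @moment_length1 m.
case: (moment 0 m) => [|[|n]] //= => [/(_ erefl) <- _|_ _].
  rewrite /falling big_ord_recl !big_ord0 subr0.
  have [->|p1] := eqVneq p (- 1); first by ring.
  have : p + 1 != 0 by rewrite addr_eq0.
  by move=> ?; field.
have -> : \prod_(2 <= i < n.+2) (p + i%:R) = rising (p + 2) n.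
  rewrite -[2%N]add0n big_addn subn2 big_mkord; apply: eq_bigr => i _.
  by rewrite natrD addrA addrAC.
have p2 : p + 1 + 1 = p + 2 by rewrite -addrA -natr1.
by rewrite !fallingN !risingS p2 !exprS; ring.
Qed.

(** The weight of z f'' comes from j (j + 1) = j + j^2. *)
Lemma expansion_b c p (f := normalized_fps c) :
  fps_z A * fps_deriv (fps_deriv f) * fps_cpow (fps_divz f) (- p) =
  expansion c (coef_b p).
Proof.
rewrite z_deriv2_normalized fps_divz_normalized fps_cpow_expansion.
rewrite linear_mul_length; apply: eq_expansion => m.
have -> : mweight (fun i => i.+1%:R * i.+2%:R) m = (moment 1 m)%:R + (moment 2 m)%:R.
  rewrite -!mweight_moment -mweightD; apply: eq_mweight => i.
  by rewrite -natrM -natrD mulnS expn1.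
rewrite /coef_b /fact_ratio_b fallingN /rising big_mkord.
have [->|] := eqVneq m mindex0; first by rewrite !moment_mindex0; ring.
rewrite -(moment_eq0 0); case: (moment 0 m) => //= n _.
by rewrite !exprS; ring.
Qed.

(** In the variables c'_j = (j + 1) c_j the derivative g = f' has the shape
    1 + sum_j c'_j z^j, and its inverse powers are values of the binomial series.
    The weight of z^2 f''' comes from (j - 1) j = j^2 - j. *)
Lemma expansion_d c (f := normalized_fps c) :
  fps_z A ^+ 2 * schwarzian f = expansion (fun i => i.+2%:R *: c i) coef_d.
Proof.
set c' := (fun i => i.+2%:R *: c i); pose g := 1 + linear_fps c' (fun=> 1).
have f1E : fps_deriv f = g.
  rewrite deriv_normalized /g linear_fps_scale.
  by congr (_ + linear_fps c _); apply/funext => i; rewrite mul1r.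
have f1V : (fps_deriv f)^-1 = fps_cpow g (- 1).
  by apply: mulr1_eq; rewrite f1E mul_fps_cpow addNr fps_cpow0.
have f1V2 : (fps_deriv f ^+ 2)^-1 = fps_cpow g (- 2).
  apply: mulr1_eq; rewrite f1E expr2 -mulrA !mul_fps_cpow.
  by rewrite (_ : - 2 + 1 + 1 = 0) ?fps_cpow0 //; ring.
pose D2 := linear_fps c' (fun i => i.+1%:R).
pose D3 := linear_fps c' (fun i => i%:R * i.+1%:R).
have zf2 : fps_z A * fps_deriv (fps_deriv f) = D2.
  by rewrite z_deriv2_normalized /D2 linear_fps_scale.
have zf3 : fps_z A ^+ 2 * fps_deriv (fps_deriv (fps_deriv f)) = D3.
  by rewrite z2_deriv3_normalized /D3 linear_fps_scale.
have -> : fps_z A ^+ 2 * schwarzian f =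
    D3 * fps_cpow g (- 1) + D3 * fps_cpow g (- 1)
    - (D2 * (D2 * fps_cpow g (- 2)) + D2 * (D2 * fps_cpow g (- 2))
       + D2 * (D2 * fps_cpow g (- 2))).
  by rewrite /schwarzian f1V f1V2 -zf2 -zf3; ring.
rewrite !fps_cpow_expansion linear_mul_linear_mul_length linear_mul_length.
rewrite !expansionD expansionN expansionD.
apply: eq_expansion => m.
rewrite mweight_M1 mweight_M2.
have -> : mweight (fun i => i%:R * i.+1%:R) m = (moment 2 m)%:R - (moment 1 m)%:R.
  rewrite -!mweight_moment -mweightB; apply: eq_mweight => i.
  by rewrite expn1 natrX -natr1; ring.
rewrite /coef_d.
have [->|] := eqVneq m mindex0; first by rewrite !moment_mindex0; ring.
rewrite -(moment_eq0 0); have := @moment_length1 m.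
case: (moment 0 m) => [|[|n]] //= => [/(_ erefl) <- _|_ _].
  by rewrite /falling !big_ord0 fact0; ring.
by rewrite !fallingN rising1 rising2 !exprS; ring.
Qed.

End Expansion.

Theorem proposition3p1 (R : realType) (A : comAlgType R[i]) (c : nat -> A)
    (p : R[i]) :
  let f := normalized_fps c in
  [/\ fps_has_sum [set: mindex]
        (fun m => fps_mono (moment 1 m)
                    ((coef_a p m / (mfact m)%:R) *: mmonom c m))
        (fps_deriv f ^+ 2 * fps_cpow (fps_divz f) (- (p + 2))),
      fps_has_sum [set m : mindex | m <> mindex0]
        (fun m => fps_mono (moment 1 m)
                    ((coef_b p m / (mfact m)%:R) *: mmonom c m))
        (fps_z A * fps_deriv (fps_deriv f) * fps_cpow (fps_divz f) (- p)) &
      fps_has_sum [set m : mindex | m <> mindex0]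
        (fun m => fps_mono (moment 1 m)
                    ((coef_d m / (mfact m)%:R) *:
                       (mmonom c m * \prod_(i <- finsupp m) i.+2%:R ^+ m i)))
        (fps_z A ^+ 2 * schwarzian f)].
Proof.
move=> f; split.
- by rewrite expansion_a; apply: expansion_has_sum => // m; case.
- rewrite expansion_b; apply: expansion_has_sum => // m /contrapT ->.
  by rewrite /coef_b !moment_mindex0 addr0 mulr0.
- rewrite expansion_d; apply: expansion_has_sum => [m|m /contrapT ->].
    congr (_ *: _); rewrite /mmonom -big_split /=; apply: eq_bigr => i _.
    by rewrite -exprMn scaler_nat mulr_natr.
  by rewrite /coef_d !moment_mindex0; ring.
Qed.
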